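(* Let $\mathcal{C}\subsetneq\mathcal{C}'\subseteq\mathcal{D}$ and let $f$ be a $\mathcal{C}$-barcoding-equivalent invariant on $\mathcal{D}$ (and thus $\mathcal{C}$-complete). Then $f$ is not $\mathcal{C}'$-complete (and thus not $\mathcal{C}'$-barcoding-equivalent).
   Context: $\mathcal{D}$ denotes an essentially small Krull-Schmidt category, i.e. an additive category whose isomorphism classes of objects form a set and in which every object decomposes as a finite direct sum of objects with local endomorphism rings. The notation $\mathcal{C}\subseteq\mathcal{D}$ means that $\mathcal{C}$ is a full subcategory of $\mathcal{D}$ containing the zero object and closed under isomorphisms, (finite) direct sums and direct summands; then $\mathcal{C}$ is also Krull-Schmidt. The notation $\mathcal{C}\subsetneq\mathcal{C}'$ means additionally $\mathcal{C}\neq\mathcal{C}'$. $\mathrm{ind}(\mathcal{D})$ is the set of isomorphism classes of indecomposable objects of $\mathcal{D}$. The split Grothendieck group $K_0^{sp}(\mathcal{D})$ is the free abelian group generated by isomorphism classes $[M]$ of objects of $\mathcal{D}$ modulo the relations $[M_1\oplus M_2]=[M_1]+[M_2]$; it is free abelian with basis $\mathrm{ind}(\mathcal{D})$. If $\mathcal{C}\subseteq\mathcal{D}$, then $K_0^{sp}(\mathcal{C})$ is regarded as the subgroup of $K_0^{sp}(\mathcal{D})$ generated by $\mathrm{ind}(\mathcal{C})\subseteq\mathrm{ind}(\mathcal{D})$. An additive invariant on $\mathcal{D}$ is a group homomorphism $f: K_0^{sp}(\mathcal{D})\to G$ for some abelian group $G$. Two additive invariants are equivalent if they have equal kernels. An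 additive invariant $f:K_0^{sp}(\mathcal{D})\to K_0^{sp}(\mathcal{C})$ is $\mathcal{C}$-barcoding if $f(c)=c$ for every $c\in K_0^{sp}(\mathcal{C})$. An additive invariant $f:K_0^{sp}(\mathcal{D})\to G$ is $\mathcal{C}$-barcoding-equivalent if it is equivalent to some $\mathcal{C}$-barcoding invariant. An additive invariant $f$ is $\mathcal{C}$-complete if $\ker f\cap K_0^{sp}(\mathcal{C})=\{0\}$. *)

(* Defs.v *)
From HB Require Import structures.
From mathcomp Require Import all_boot all_order all_algebra.
From mathcomp Require Import boolp.
From mathcomp.multinomials Require Import freeg.

Set Implicit Arguments.
Unset Strict Implicit.
Unset Printing Implicit Defensive.

Import GRing.Theory.
Local Open Scope ring_scope.

Record preadditive_category := PreadditiveCategory {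
  obj :> Type;
  hom : obj -> obj -> zmodType;
  idm : forall X, hom X X;
  comp : forall X Y Z, hom Y Z -> hom X Y -> hom X Z;
  comp1m : forall X Y (f : hom X Y), comp (idm Y) f = f;
  compm1 : forall X Y (f : hom X Y), comp f (idm X) = f;
  compmA : forall W X Y Z (h : hom Y Z) (g : hom X Y) (f : hom W X),
    comp h (comp g f) = comp (comp h g) f;
  compDl : forall X Y Z (g g' : hom Y Z) (f : hom X Y),
    comp (g + g') f = comp g f + comp g' f;
  compDr : forall X Y Z (g : hom Y Z) (f f' : hom X Y),
    comp g (f + f') = comp g f + comp g f'
}.

Arguments hom {p} X Y : rename.
Arguments idm {p} X : rename.
Arguments comp {p X Y Z} g f : rename.
Notation "g \c f" := (comp g f) (at level 40, left associativity, format "g  \c  f").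

Section Preadditive.
Variable D : preadditive_category.
Implicit Types X Y Z A B : D.

Definition isomorphic X Y :=
  exists (f : hom X Y) (g : hom Y X), g \c f = idm X /\ f \c g = idm Y.

Definition zero_object Z :=
  forall X, (exists! f : hom X Z, True) /\ (exists! f : hom Z X, True).

Definition direct_sum X A B :=
  exists (i : hom A X) (j : hom B X) (p : hom X A) (q : hom X B),
    [/\ p \c i = idm A, q \c j = idm B, q \c i = 0, p \c j = 0
      & i \c p + j \c q = idm X].

Definition finite_direct_sum X n (F : 'I_n -> D) :=
  exists (i : forall k, hom (F k) X) (p : forall k, hom X (F k)),
    [/\ forall k, p k \c i k = idm (F k),
        forall k l, k != l -> p k \c i l = 0
      & \sum_(k < n) i k \c p k = idm X].

Definition additive_category :=
  (exists Z, zero_object Z) /\ (forall A B, exists X, direct_sum X A B).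

Definition End X : Type := hom X X.
HB.instance Definition _ X := GRing.Zmodule.on (End X).

Definition End_mul X (g f : End X) : End X := g \c f.
Definition End_one X : End X := idm X.

Lemma End_mulA X : associative (@End_mul X).
Proof. by move=> h g f; apply: compmA. Qed.
Lemma End_mul1r X : left_id (End_one X) (@End_mul X).
Proof. by move=> f; apply: comp1m. Qed.
Lemma End_mulr1 X : right_id (End_one X) (@End_mul X).
Proof. by move=> f; apply: compm1. Qed.
Lemma End_mulDl X : left_distributive (@End_mul X) +%R.
Proof. by move=> g g' f; apply: compDl. Qed.
Lemma End_mulDr X : right_distributive (@End_mul X) +%R.
Proof. by move=> g f f'; apply: compDr. Qed.

HB.instance Definition _ X := GRing.Zmodule_isPzRing.Build (End X)
  (@End_mulA X) (@End_mul1r X) (@End_mulr1 X) (@End_mulDl X) (@End_mulDr X).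

Definition indecomposable X :=
  ~ zero_object X /\
  forall A B, direct_sum X A B -> zero_object A \/ zero_object B.

(* The relation C <= E between classes of objects, that is, full
   subcategories of D; for E a subcategory of D in this sense, "zero object",
   "isomorphic" and "direct sum" mean the same in E and in D. *)
Definition subcategory (C E : D -> Prop) :=
  [/\ forall X, C X -> E X,
      exists2 Z, zero_object Z & C Z,
      forall X Y, E Y -> isomorphic X Y -> C X -> C Y,
      forall X A B, E X -> direct_sum X A B -> C A -> C B -> C X
    & forall X A B, E A -> E B -> direct_sum X A B -> C X -> C A /\ C B].

End Preadditive.

(* In a noncommutative ring, "local" means that the non-units are closed
   under addition (equivalently, form a two-sided ideal). *)
Definition local_ring (R : pzRingType) :=
  let unit (a : R) := exists b, b * a = 1 /\ a * b = 1 in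
  1 <> 0 :> R /\ forall a b : R, ~ unit a -> ~ unit b -> ~ unit (a + b).

(* The set of isomorphism classes is part of the structure, so that the type
   of objects may live in a larger universe than the Grothendieck group. It is
   determined up to a unique bijection compatible with iso_class. *)
Record essentially_small_category := EssentiallySmallCategory {
  underlying :> preadditive_category;
  iso_classes : choiceType;
  iso_class : underlying -> iso_classes;
  iso_class_surj : forall c, exists X, iso_class X = c;
  iso_classE : forall X Y, iso_class X = iso_class Y <-> isomorphic X Y
}.

Arguments iso_class {e} X : rename.

Definition krull_schmidt (D : essentially_small_category) :=
  additive_category D /\
  forall X : D, exists n (F : 'I_n -> D),
    finite_direct_sum X F /\ forall k, local_ring (End (F k)).

Section GeneratedSubgroup.
Variables (V : zmodType) (S : V -> Prop).

Inductive in_generated : V -> Prop :=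
  | generated_gen x : S x -> in_generated x
  | generated0 : in_generated 0
  | generatedB x y : in_generated x -> in_generated y -> in_generated (x - y).

Definition generated : {pred V} := fun x => `[< in_generated x >].

Lemma generated_zmod_closed : zmod_closed generated.
Proof.
split; first by apply/asboolP; apply: generated0.
by move=> x y /asboolP hx /asboolP hy; apply/asboolP; apply: generatedB.
Qed.

HB.instance Definition _ := GRing.isZmodClosed.Build V generated
  generated_zmod_closed.

Record generated_subgroup := GeneratedSubgroup {
  generated_val :> V;
  generated_valP : generated_val \in generated
}.

HB.instance Definition _ := [isSub for generated_val].
HB.instance Definition _ := [Choice of generated_subgroup by <:].
HB.instance Definition _ :=
  [SubChoice_isSubZmodule of generated_subgroup by <:].

End GeneratedSubgroup.

Section SplitGrothendieckGroup.
Variable D : essentially_small_category.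

Definition split_relation (r : {freeg (iso_classes D) / int}) :=
  exists M M1 M2 : D, direct_sum M M1 M2 /\
    r = << iso_class M >> - (<< iso_class M1 >> + << iso_class M2 >>).

Definition K0sp : zmodType := {ideal_quot (generated split_relation)}.

Definition K0_class (M : D) : K0sp :=
  (\pi_({ideal_quot (generated split_relation)}) << iso_class M >>)%qT.

Definition ind_class (C : D -> Prop) (x : K0sp) :=
  exists M : D, [/\ C M, indecomposable M & x = K0_class M].

Definition K0sub (C : D -> Prop) := generated (ind_class C).

Definition K0sp_sub (C : D -> Prop) : zmodType :=
  generated_subgroup (ind_class C).

Definition equivalent (G H : zmodType)
    (f : {additive K0sp -> G}) (g : {additive K0sp -> H}) :=
  forall x, f x = 0 <-> g x = 0.

Definition barcoding (C : D -> Prop) (f : {additive K0sp -> K0sp_sub C}) :=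
  forall c : K0sp_sub C, f (val c) = c.

Definition barcoding_equivalent (C : D -> Prop) (G : zmodType)
    (f : {additive K0sp -> G}) :=
  exists g : {additive K0sp -> K0sp_sub C}, barcoding g /\ equivalent f g.

Definition complete (C : D -> Prop) (G : zmodType)
    (f : {additive K0sp -> G}) :=
  forall x, f x = 0 -> x \in K0sub C -> x = 0.

End SplitGrothendieckGroup.

(* Main.v *)
(* If f is equivalent to a C-barcoding g, pick an indecomposable M in C' but not
   in C; then [M] - g[M] lies in K0(C') and is killed by g, hence by f. It is
   nonzero because [M] is not in K0(C): the multiplicity of M in an object X,
   that is, the rank of the composition pairing Hom(X, M) x Hom(M, X) -> k with
   values in the residue division ring k of End(M), is additive on direct sums,
   equals 1 on M, and vanishes on the objects of C. *)
From Pilot Require Import Defs.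
From HB Require Import structures.
From mathcomp.multinomials Require Import freeg.
From mathcomp Require Import all_boot all_order all_algebra.
From mathcomp Require Import boolp.

Set Implicit Arguments.
Unset Strict Implicit.
Unset Printing Implicit Defensive.

Import GRing.Theory.
(* Restores [hom], which mathcomp's vector.v shadows. *)
Import Pilot.Defs.
Local Open Scope ring_scope.

(** * Local rings and rank modulo non-units *)

Definition invertible (R : pzRingType) (a : R) := exists b, b * a = 1 /\ a * b = 1.

Section LocalRing.
Variables (R : pzRingType) (hR : local_ring R).
Implicit Types a b : R.

Lemma local_ringD a b :
  ~ invertible a -> ~ invertible b -> ~ invertible (a + b).
Proof. by case: hR => _ h; apply: h. Qed.

Lemma invertible1 : invertible (1 : R).
Proof. by exists 1; rewrite mulr1. Qed.

Lemma invertibleN a : invertible (- a) -> invertible a.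
Proof. by case=> b [h h']; exists (- b); rewrite mulNr -mulrN h mulrN -mulNr. Qed.

Lemma not_invertible0 : ~ invertible (0 : R).
Proof. by case=> b []; rewrite mulr0 => /esym h; case: hR. Qed.

(** Since [e] and [1 - e] add up to 1, one of them is a unit, and an invertible idempotent equals
    1. *)
Lemma local_idempotent (e : R) : e * e = e -> e = 0 \/ e = 1.
Proof.
move=> ee.
have inv1 (c : R) : c * c = c -> invertible c -> c = 1.
  by move=> cc [b [bc _]]; rewrite -[c]mul1r -bc -mulrA cc.
case: (pselect (invertible e)) => [/(inv1 _ ee)|he]; first by right.
case: (pselect (invertible (1 - e))) => [|hf].
  move/inv1 => h; left; apply/eqP; rewrite -subr_eq0 -[e - 0]opprB sub0r oppr_eq0.
  have /h : (1 - e) * (1 - e) = 1 - e.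
    by rewrite mulrBr mulr1 mulrBl mul1r ee subrr subr0.
  by move/eqP; rewrite subr_eq addrC -subr_eq subrr eq_sym oppr_eq0.
by case: (local_ringD he hf); rewrite addrC subrK; apply: invertible1.
Qed.

(** The product [a * b] is idempotent; if it were 0, then [1 = b * (a * b) * a] would vanish. *)
Lemma local_left_inverse a b : b * a = 1 -> a * b = 1.
Proof.
move=> ba; case: (@local_idempotent (a * b)) => //.
  by rewrite mulrA -(mulrA a) ba mulr1.
move=> ab0; case: hR => h _; case: h.
by rewrite -(mulr1 1) -ba mulrA -(mulrA b) ab0 mulr0 mul0r.
Qed.

Lemma not_invertibleMl a b : ~ invertible a -> ~ invertible (b * a).
Proof.
move=> ha [c [cba _]]; apply: ha; exists (c * b).
by have h : c * b * a = 1 by [rewrite -mulrA]; split=> //; apply: local_left_inverse.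
Qed.

Lemma not_invertibleMr a b : ~ invertible a -> ~ invertible (a * b).
Proof.
move=> ha [c [_ abc]]; apply: ha; exists (b * c).
have h : a * (b * c) = 1 by rewrite mulrA.
by split=> //; apply: local_left_inverse.
Qed.

Lemma not_invertible_sum (I : finType) (F : I -> R) :
  (forall i, ~ invertible (F i)) -> ~ invertible (\sum_i F i).
Proof.
move=> hF; apply: (big_ind (fun x => ~ invertible x)) => //.
  exact: not_invertible0.
exact: local_ringD.
Qed.

Lemma not_invertibleB a b :
  ~ invertible a -> ~ invertible b -> ~ invertible (a - b).
Proof. by move=> ha hb; apply: local_ringD => // /invertibleN. Qed.

(* Gaussian elimination over the residue division ring, without forming it. *)
Lemma local_underdetermined r n (Q : 'I_r -> 'I_n -> R) : (r < n)%N ->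
  exists2 v : 'I_n -> R, exists i, invertible (v i) &
    forall k, ~ invertible (\sum_i Q k i * v i).
Proof.
elim: r n Q => [|r IHr] [//|n] Q rn.
  exists (fun=> 1); first by exists ord0; apply: invertible1.
  by case.
case: (pselect (exists j, invertible (Q ord0 j))) => [[j [q [_ Qq]]]|noinv].
  (* Schur complement of the pivot [Q ord0 j], whose inverse is [q]. *)
  pose Q' k i := Q k (lift j i) - Q k j * q * Q ord0 (lift j i).
  have [v' [i0 vi0] hv'] := IHr n (fun k => Q' (lift ord0 k)) rn.
  (* The coordinate [j] is chosen to solve row 0 exactly; on the other rows [v] then acts as [v']
     under [Q']. *)
  pose v i := if unlift j i is Some i' then v' i'
              else - \sum_i' q * Q ord0 (lift j i') * v' i'.
  have vE k : \sum_i Q k i * v i = \sum_i Q' k i * v' i.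
    rewrite (bigD1_ord j) //= {1}/v unlift_none mulrN addrC.
    rewrite big_distrr -sumrB; apply: eq_bigr => i _ /=.
    by rewrite /v liftK mulrBl !mulrA.
  exists v; first by exists (lift j i0); rewrite /v liftK.
  move=> k; rewrite vE; case: (unliftP ord0 k) => [k' ->|->]; first exact: hv'.
  rewrite big1 => [|i _]; first exact: not_invertible0.
  by rewrite /Q' Qq mul1r subrr mul0r.
(* A row of non-units pairs to a non-unit with every vector, so only the remaining rows impose
   conditions. *)
have [v vi hv] := IHr n.+1 (fun k => Q (lift ord0 k)) (ltnW rn).
exists v => // k; case: (unliftP ord0 k) => [k' ->|->]; first exact: hv.
apply: not_invertible_sum => i; apply: not_invertibleMr => hi.
by apply: noinv; exists i.
Qed.

(** If [r < n], some [v] with a unit entry has [Q v] zero modulo non-units; as [P Q] is congruent to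
    the identity, that entry would be a non-unit. *)
Lemma local_rank_le r n (P : 'I_n -> 'I_r -> R) (Q : 'I_r -> 'I_n -> R) :
  (forall i j, ~ invertible (\sum_k P i k * Q k j - (i == j)%:R)) -> (n <= r)%N.
Proof.
move=> hPQ; rewrite leqNgt; apply/negP => rn.
have [v [i vi] hv] := local_underdetermined Q rn.
(* This is [v = P (Q v) - (P Q - 1) v] at [i]; neither term is a unit. *)
suff vE : v i = (\sum_k P i k * (\sum_j Q k j * v j)) -
    \sum_j (\sum_k P i k * Q k j - (i == j)%:R) * v j.
  move: vi; rewrite vE; apply: not_invertibleB; apply: not_invertible_sum => j.
    exact: not_invertibleMl.
  exact: not_invertibleMr.
under [X in X - _]eq_bigr do rewrite big_distrr.
under [X in _ - X]eq_bigr do rewrite mulrBl big_distrl.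
rewrite exchange_big sumrB opprB addrC /=.
rewrite (bigD1 i) //= eqxx mul1r big1 => [|j /negbTE]; last first.
  by rewrite eq_sym => ->; rewrite mul0r.
rewrite addr0 addrAC -addrA -sumrB big1 ?addr0 // => j _.
by apply/eqP; rewrite subr_eq0; apply/eqP/eq_bigr => k _; rewrite mulrA.
Qed.

End LocalRing.

(** * Multiplicity of an object with local endomorphism ring *)

Section Multiplicity.
Variable D : preadditive_category.
Implicit Types X Y Z A B M N : D.

Lemma comp0m X Y Z (f : hom X Y) : (0 : hom Y Z) \c f = 0.
Proof. by apply: (addIr (0 \c f)); rewrite -compDl !add0r. Qed.

Lemma compm0 X Y Z (g : hom Y Z) : g \c (0 : hom X Y) = 0.
Proof. by apply: (addIr (g \c 0)); rewrite -compDr !add0r. Qed.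

Lemma comp_suml (I : finType) X Y Z (g : I -> hom Y Z) (f : hom X Y) :
  (\sum_i g i) \c f = \sum_i g i \c f.
Proof.
by apply: (big_morph (comp^~ f)) => [a b|]; [apply: compDl|apply: comp0m].
Qed.

Lemma comp_sumr (I : finType) X Y Z (g : hom Y Z) (f : I -> hom X Y) :
  g \c (\sum_i f i) = \sum_i g \c f i.
Proof.
by apply: (big_morph (comp g)) => [a b|]; [apply: compDr|apply: compm0].
Qed.

Lemma zero_object_id Z : zero_object Z <-> idm Z = 0.
Proof.
split=> [hZ|id0 X].
  by case: (hZ Z) => _ [f [_ fP]]; rewrite -(fP (idm Z)) // -(fP 0).
split; exists 0; split=> // f _.
  by rewrite -(comp1m f) id0 comp0m.
by rewrite -(compm1 f) id0 compm0.
Qed.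

Lemma isomorphic_sym X Y : isomorphic X Y -> isomorphic Y X.
Proof. by case=> f [g [gf fg]]; exists g, f. Qed.

Lemma isomorphic_trans X Y Z :
  isomorphic X Y -> isomorphic Y Z -> isomorphic X Z.
Proof.
move=> [f [g [gf fg]]] [h [k [kh hk]]]; exists (h \c f), (g \c k); split.
  by rewrite compmA -(compmA g) kh compm1.
by rewrite compmA -(compmA h) fg compm1.
Qed.

(** An arbitrary finite index type lets one additivity lemma serve binary sums ([bool]),
    isomorphisms ([unit]) and finite sums (['I_n]). *)
Definition biproduct X (I : finType) (F : I -> D)
    (i : forall k, hom (F k) X) (p : forall k, hom X (F k)) :=
  [/\ forall k, p k \c i k = idm (F k),
      forall k l, k != l -> p k \c i l = 0
    & \sum_k i k \c p k = idm X].

(* [M] has multiplicity [#|I|] in [X] when [Hom(X, M)] and [Hom(M, X)] have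
   dual bases for the pairing by composition, modulo radicals. *)
Definition dual_bases M X (I : finType)
    (a : I -> hom X M) (b : I -> hom M X) :=
  (forall k l, ~ invertible ((a k \c b l : End M) - (k == l)%:R)) /\
  (forall (f : hom M X) (g : hom X M),
    ~ invertible ((g \c f : End M) - \sum_k (g \c b k) \c (a k \c f))).

Definition multiplicity M X r :=
  exists (a : 'I_r -> hom X M) (b : 'I_r -> hom M X), dual_bases a b.

Variables (M : D) (hM : local_ring (End M)).

Lemma dual_bases_multiplicity X (I : finType)
    (a : I -> hom X M) (b : I -> hom M X) :
  dual_bases a b -> multiplicity M X #|I|.
Proof.
case=> hab hgf; exists (a \o enum_val), (b \o enum_val); split=> [k l|f g] /=.
  by rewrite -(inj_eq enum_val_inj).
have := hgf f g; rewrite (reindex (@enum_val I I)) //.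
exact/onW_bij/enum_val_bij.
Qed.

(** Expanding each [a k \c b k'] in the second pair of dual bases factors the identity matrix of
    size [r], modulo non-units, through size [s]. *)
Lemma multiplicity_le X r s :
  multiplicity M X r -> multiplicity M X s -> (r <= s)%N.
Proof.
move=> [a [b [hab _]]] [a' [b' [_ hgf]]].
apply: (local_rank_le hM (P := fun k l => a k \c b' l)
  (Q := fun l k => a' l \c b k)) => k k'.
have := not_invertibleB hM (hab k k') (hgf (b k') (a k)).
by rewrite opprB addrC addrA subrK.
Qed.

Lemma multiplicity_uniq X r s :
  multiplicity M X r -> multiplicity M X s -> r = s.
Proof.
by move=> hr hs; apply/eqP; rewrite eqn_leq !(multiplicity_le (X := X)).
Qed.

(** Dual bases of the summands, transported along [i] and [p], together form dual bases of [X]: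
    orthogonality makes their pairing matrix block diagonal. *)
Lemma multiplicity_biproduct X (I : finType) (F : I -> D)
    (i : forall k, hom (F k) X) (p : forall k, hom X (F k)) (r : I -> nat) :
  biproduct i p -> (forall k, multiplicity M (F k) (r k)) ->
  multiplicity M X (\sum_k r k).
Proof.
move=> [pi1 pi0 ip] /(_ _)/cid hF.
pose a k := projT1 (hF k); pose b k := projT1 (cid (projT2 (hF k))).
have hab k : dual_bases (a k) (b k) := projT2 (cid (projT2 (hF k))).
pose J := {k : I & 'I_(r k)}.
pose a' (x : J) := a (tag x) (tagged x) \c p (tag x).
pose b' (x : J) := i (tag x) \c b (tag x) (tagged x).
suff /dual_bases_multiplicity : dual_bases a' b'.
  rewrite card_tagged sumnE big_map big_enum /=.
  by under eq_bigr do rewrite card_ord.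
split=> [[k l] [k' l']|f g].
  rewrite /a' /b' /= compmA -(compmA (a k l)).
  have [kk'|kk'] := eqVneq k k'.
    move: l l'; rewrite -kk' => l l'.
    by rewrite pi1 compm1 eq_Tagged; apply: (hab k).1.
  rewrite pi0 // compm0 comp0m -tag_eqE /tag_eq /= (negbTE kk') subr0.
  exact: not_invertible0.
(* Inserting [\sum_k i k \c p k = idm X] splits the pairing into those of the summands. *)
have -> : g \c f = \sum_k (g \c i k) \c (p k \c f).
  rewrite -{1}(comp1m f) -ip comp_suml comp_sumr.
  by apply: eq_bigr => k _; rewrite !compmA.
have -> : \sum_x (g \c b' x) \c (a' x \c f) =
    \sum_k \sum_l ((g \c i k) \c b k l) \c (a k l \c (p k \c f)).
  rewrite sig_big_dep; apply: eq_bigr => x _.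
  by rewrite !compmA.
rewrite -sumrB.
apply: not_invertible_sum => // k.
exact: (hab k).2.
Qed.

Lemma multiplicity_direct_sum X A B a b : direct_sum X A B ->
  multiplicity M A a -> multiplicity M B b -> multiplicity M X (a + b).
Proof.
move=> [i [j [p [q [pi qj qi pj ip]]]]] ha hb.
pose F (k : bool) := if k then A else B.
pose inj k : hom (F k) X := if k is true then i else j.
pose proj k : hom X (F k) := if k is true then p else q.
have := @multiplicity_biproduct X bool F inj proj (fun k => if k then a else b).
rewrite big_bool; apply; last by case.
by split=> [[]|[] []|] //; rewrite big_bool.
Qed.

Lemma multiplicity_isomorphic X Y r :
  isomorphic X Y -> multiplicity M X r -> multiplicity M Y r.
Proof.
move=> [u [v [vu uv]]] hr.
have := @multiplicity_biproduct Y unit (fun=> X) (fun=> u) (fun=> v) (fun=> r).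
rewrite big_const card_unit /= addn0; apply=> //.
by split=> [//|[] [] //|]; rewrite big_const card_unit /= addr0.
Qed.

Lemma multiplicity_self : multiplicity M M 1.
Proof.
exists (fun=> idm M), (fun=> idm M); split=> [k l|f g].
  by rewrite !ord1 eqxx comp1m subrr; apply: not_invertible0.
by rewrite big_ord1 compm1 comp1m subrr; apply: not_invertible0.
Qed.

(** Empty dual bases work unless some [g \c f] is a unit. Then [M] is a retract of [N], with
    idempotent 0 or 1 in [End N]: 0 contradicts [idm M <> 0], and 1 makes [M] and [N] isomorphic. *)
Lemma multiplicity_local N : local_ring (End N) -> ~ isomorphic M N ->
  multiplicity M N 0.
Proof.
move=> hN MN; exists (fun=> 0), (fun=> 0); split=> [[]//|f g].
rewrite big_ord0 subr0 => -[b [/= bgf _]].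
have gf : (b \c g) \c f = idm M by rewrite -compmA.
have ee : (f \c (b \c g) : End N) * (f \c (b \c g)) = f \c (b \c g).
  by rewrite [LHS]compmA -(compmA f) gf compm1.
case: (local_idempotent hN ee) => [e0|e1].
  case: hM => h _; case: h; rewrite -[1]/(idm M).
  have -> : idm M = (b \c g) \c (f \c (b \c g)) \c f.
    by rewrite compmA gf comp1m gf.
  by rewrite e0 compm0 comp0m.
by case: MN; exists f, (b \c g).
Qed.

(** The projection of [M] onto [A] is an idempotent of a local ring: if it is 0 then [A] vanishes,
    if it is 1 then [B] does. *)
Lemma local_indecomposable : indecomposable M.
Proof.
case: (hM) => h10 _; split=> [/zero_object_id/h10 //|A B].
move=> [i [j [p [q [pi qj qi pj ip]]]]].
have ee : (i \c p : End M) * (i \c p) = i \c p.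
  by rewrite [LHS]compmA -(compmA i) pi compm1.
case: (local_idempotent hM ee) => [e0|e1]; [left|right]; apply/zero_object_id.
  have -> : idm A = (p \c (i \c p)) \c i by rewrite compmA pi comp1m pi.
  by rewrite e0 compm0 comp0m.
have -> : idm B = (q \c (j \c q)) \c j by rewrite compmA qj comp1m qj.
have -> : j \c q = 0 by apply: (addrI (i \c p)); rewrite ip addr0 e1.
by rewrite compm0 comp0m.
Qed.

End Multiplicity.

(** * Finite direct sums in additive categories *)

Section FiniteSums.
Variable D : preadditive_category.
Implicit Types X Y Z A B : D.

Lemma biproduct_comp X Y Z n (F : 'I_n -> D)
    (j : forall k, hom (F k) Y) (q : forall k, hom Y (F k))
    (a : forall k, hom (F k) Z) (b : forall k, hom X (F k)) :
  (forall k, q k \c j k = idm (F k)) ->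
  (forall k l, k != l -> q k \c j l = 0) ->
  (\sum_k a k \c q k) \c (\sum_k j k \c b k) = \sum_k a k \c b k.
Proof.
move=> qj1 qj0; rewrite comp_suml; apply: eq_bigr => k _.
rewrite comp_sumr (bigD1 k) //= big1 => [|l lk].
  by rewrite addr0 -compmA (compmA (q k)) qj1 comp1m.
by rewrite -compmA (compmA (q k)) qj0 ?comp0m ?compm0 // eq_sym.
Qed.

(* A family of composites avoids transporting the maps along [k = 0] or
   [k = lift 0 k'] when adding a summand. *)
Lemma finite_direct_sum_idempotents X n (F : 'I_n -> D) (e : 'I_n -> hom X X) :
  (forall k, exists (i : hom (F k) X) (p : hom X (F k)),
    p \c i = idm (F k) /\ i \c p = e k) ->
  (forall k l, k != l -> e k \c e l = 0) -> \sum_k e k = idm X ->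
  finite_direct_sum X F.
Proof.
move=> /(_ _)/cid h e0 e1.
pose i k := projT1 (h k); pose p k := projT1 (cid (projT2 (h k))).
have ip k : p k \c i k = idm (F k) /\ i k \c p k = e k :=
  projT2 (cid (projT2 (h k))).
exists i, p; split=> [k|k l kl|]; first exact: (ip k).1.
  rewrite -(comp1m (p k)) -(compm1 (i l)) -(ip k).1 -(ip l).1.
  rewrite -(compmA (p k)) (ip k).2 (compmA (i l)) (ip l).2 -compmA.
  by rewrite (compmA (e k)) e0 // comp0m compm0.
by rewrite -e1; apply: eq_bigr => k _; apply: (ip k).2.
Qed.

Lemma finite_direct_sum_exists n (F : 'I_n -> D) : additive_category D ->
  exists X, finite_direct_sum X F.
Proof.
move=> [[Z hZ] hsum]; elim: n F => [|n IHn] F.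
  exists Z; apply: (finite_direct_sum_idempotents (e := fun=> 0)) => [[]//|[]//|].
  by rewrite big_ord0; apply/esym/zero_object_id.
have [Y [j [q [qj1 qj0 jq]]]] := IHn (fun k => F (lift ord0 k)).
have [X [i [J [p [Q [pi QJ Qi pJ ip]]]]]] := hsum (F ord0) Y.
(* The idempotents of the summands: the first is split off directly, the others factor through
   [Y]. *)
exists X; pose e k := if unlift ord0 k is Some k' then
  (J \c j k') \c (q k' \c Q) else i \c p.
apply: (finite_direct_sum_idempotents (e := e)) => [k|k l|].
- case: (unliftP ord0 k) => [k'|] ->; last by exists i, p; rewrite /e unlift_none.
  exists (J \c j k'), (q k' \c Q); rewrite /e liftK; split=> //.
  by rewrite compmA -(compmA (q k')) QJ compm1.
- rewrite /e; case: (unliftP ord0 k) => [k'|] ->; case: (unliftP ord0 l) => [l'|] -> //.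
  + rewrite (inj_eq lift_inj) => kl.
    rewrite -compmA (compmA (q k' \c Q)) (compmA (q k' \c Q)) -(compmA (q k')).
    by rewrite QJ compm1 qj0 // comp0m compm0.
  + by move=> _; rewrite -!compmA (compmA Q) Qi comp0m !compm0.
  + by move=> _; rewrite -!compmA (compmA p) pJ comp0m !compm0.
rewrite big_ord_recl /e unlift_none -ip; congr (_ + _).
under eq_bigr do rewrite liftK -compmA (compmA (j _)).
by rewrite -comp_sumr -comp_suml jq comp1m.
Qed.

(** The complement [Y] is built anew as a direct sum of the remaining summands, then mapped to and
    from [X] one summand at a time. *)
Lemma finite_direct_sum_recl X n (F : 'I_n.+1 -> D) : additive_category D ->
  finite_direct_sum X F ->
  exists2 Y, finite_direct_sum Y (fun k => F (lift ord0 k)) &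
    direct_sum X (F ord0) Y.
Proof.
move=> hD [i [p [pi1 pi0 ip]]].
have [Y hY] := finite_direct_sum_exists (fun k => F (lift ord0 k)) hD.
exists Y => //; case: hY => [j [q [qj1 qj0 jq]]].
exists (i ord0), (\sum_k i (lift ord0 k) \c q k), (p ord0),
  (\sum_k j k \c p (lift ord0 k)); split => //.
- rewrite (@biproduct_comp _ _ _ _ (fun k => F (lift ord0 k))) // => k l kl.
  by rewrite pi0 // (inj_eq lift_inj).
- by rewrite comp_suml big1 // => k _; rewrite -compmA pi0 // compm0.
- by rewrite comp_sumr big1 // => k _; rewrite compmA pi0 // comp0m.
by rewrite (@biproduct_comp _ _ _ _ (fun k => F (lift ord0 k))) // -ip big_ord_recl.
Qed.

Lemma finite_direct_sum0 X (F : 'I_0 -> D) :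
  finite_direct_sum X F -> zero_object X.
Proof. by case=> i [p [_ _]]; rewrite big_ord0 => /esym/zero_object_id. Qed.

Lemma zero_object_isomorphic X Y :
  zero_object X -> zero_object Y -> isomorphic X Y.
Proof.
by move=> /zero_object_id hX /zero_object_id hY; exists 0, 0; rewrite !comp0m.
Qed.

(** Reduces membership in a subcategory to membership of the summands, by peeling off one at a time;
    the empty sum is isomorphic to the zero object of [C]. *)
Lemma subcategory_finite_direct_sum (C : D -> Prop) X n (F : 'I_n -> D) :
  additive_category D -> subcategory C (fun=> True) -> finite_direct_sum X F ->
  C X <-> forall k, C (F k).
Proof.
move=> hD [_ [Z hZ CZ] Ciso Csum Csummand].
elim: n X F => [|n IHn] X F hX.
  split=> [_ []//|_]; apply: (Ciso Z) => //.
  by apply: zero_object_isomorphic => //; apply: finite_direct_sum0 hX.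
have [Y hY hX'] := finite_direct_sum_recl hD hX.
split=> [/(Csummand _ _ _ I I hX')[CF0 CY] k|CF].
  by case: (unliftP ord0 k) => [k'|] -> //; apply: (IHn _ _ hY).1 k'.
by apply: (Csum _ _ _ I hX') => //; apply/(IHn _ _ hY).
Qed.

Lemma subcategory_trans (C E T : D -> Prop) :
  subcategory C E -> subcategory E T -> subcategory C T.
Proof.
move=> [CE Czero Ciso Csum Csummand] [ET _ Eiso Esum Esummand].
split=> // [X /CE/ET //|X Y TY XY CX|X A B TX hX CA CB|X A B TA TB hX CX].
- by apply: (Ciso X) => //; apply: (Eiso X) => //; apply: CE.
- apply: (Csum X A B) => //; apply: (Esum X A B) => //; exact: CE.
have [EA EB] := Esummand _ _ _ TA TB hX (CE _ CX).
exact: Csummand hX CX.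
Qed.

End FiniteSums.

(** * Multiplicity as a functional on the free group of isomorphism classes *)

Section KrullSchmidt.
Variables (D : essentially_small_category) (hD : krull_schmidt D).
Variables (M : D) (hM : local_ring (End M)).

(** A summand with local endomorphism ring contributes 1 if it is isomorphic to [M] and 0
    otherwise. *)
Lemma multiplicity_exists (X : D) : exists r, multiplicity M X r.
Proof.
have [n [F [[i [p hX]] hF]]] := hD.2 X.
have /choice[r hr] : forall k, exists r, multiplicity M (F k) r.
  move=> k; case: (pselect (isomorphic M (F k))) => MF.
    exists 1%N; apply: multiplicity_isomorphic MF _ => //.
    exact: multiplicity_self.
  by exists 0%N; apply: multiplicity_local.
by exists (\sum_k r k)%N; apply: (multiplicity_biproduct hM hX).
Qed.

(** The local summands of [X] lie in [C], so none is isomorphic to [M]. *)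
Lemma multiplicity_subcategory (C : D -> Prop) (X : D) :
  subcategory C (fun=> True) -> ~ C M -> C X -> multiplicity M X 0.
Proof.
move=> hC CM CX; have [n [F [hX hF]]] := hD.2 X.
have CF := (subcategory_finite_direct_sum hD.1 hC hX).1 CX.
case: hX => [i [p hX]].
have -> : 0%N = (\sum_(k < n) 0)%N by rewrite big1.
apply: (multiplicity_biproduct hM hX) => k.
apply: multiplicity_local => // MF; apply: CM.
case: hC => _ _ Ciso _ _; apply: Ciso (CF k) => //.
exact: isomorphic_sym.
Qed.

Definition class_multiplicity (c : iso_classes D) : nat :=
  projT1 (cid (multiplicity_exists (projT1 (cid (iso_class_surj c))))).

Lemma class_multiplicityE (X : D) r :
  multiplicity M X r -> class_multiplicity (iso_class X) = r.
Proof.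
move=> hr; rewrite /class_multiplicity; case: cid => Y /= hY; case: cid => s /= hs.
by apply: (multiplicity_uniq hM hs); apply: multiplicity_isomorphic hr => //;
  apply/iso_classE.
Qed.

(** Kept on the free group: vanishing on the split relations is enough to compare two lifts of one
    class. [int^o] is the integers as a module over themselves. *)
Definition multiplicity_sum : {freeg (iso_classes D) / int} -> int :=
  fglift (fun c => (class_multiplicity c)%:Z : int^o).

Lemma multiplicity_sum_is_zmod_morphism : zmod_morphism multiplicity_sum.
Proof. exact: (@lift_is_additive _ _ int^o). Qed.

HB.instance Definition _ := GRing.isZmodMorphism.Build
  {freeg (iso_classes D) / int} int multiplicity_sum
  multiplicity_sum_is_zmod_morphism.

Lemma multiplicity_sumU c : multiplicity_sum << c >> = class_multiplicity c.
Proof. by rewrite /multiplicity_sum liftU [LHS]mul1r. Qed.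

Lemma multiplicity_sum_relation r :
  r \in generated (@split_relation D) -> multiplicity_sum r = 0.
Proof.
move=> /asboolP; elim=> {r} [r [X [A [B [hX ->]]]]||x y _ hx _ hy].
- have [a ha] := multiplicity_exists A; have [b hb] := multiplicity_exists B.
  rewrite raddfB raddfD /= !multiplicity_sumU (class_multiplicityE ha).
  rewrite (class_multiplicityE hb).
  rewrite (class_multiplicityE (multiplicity_direct_sum hM hX ha hb)).
  by rewrite PoszD subrr.
- exact: raddf0.
by rewrite raddfB /= hx hy subrr.
Qed.

Lemma K0_class_notin_K0sub (C : D -> Prop) :
  subcategory C (fun=> True) -> ~ C M -> K0_class M \notin K0sub C.
Proof.
move=> hC CM; apply/negP => /asboolP MC.
(* Every element of the subgroup of [C] has a lift on which the functional vanishes. *)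
have lift0 (z : K0sp D) : in_generated (ind_class C) z ->
    exists2 y, (\pi_({ideal_quot (generated (@split_relation D))}) y)%qT = z &
      multiplicity_sum y = 0.
  elim=> {z} [x [X [CX _ ->]]||_ _ _ [x <- hx] _ [y <- hy]].
  - exists << iso_class X >> => //; rewrite multiplicity_sumU.
    by rewrite (class_multiplicityE (multiplicity_subcategory hC CM CX)).
  - by exists 0; rewrite ?rmorph0 //; apply: raddf0.
  exists (x - y); first by rewrite raddfB.
  by rewrite raddfB /= hx hy subrr.
(* Two lifts of the class of [M] differ by split relations, yet have functional values 0 and 1. *)
have [y /eqP yM y0] := lift0 _ MC; move: yM; rewrite -Quotient.idealrBE => /multiplicity_sum_relation.
rewrite raddfB /= y0 sub0r multiplicity_sumU.
by rewrite (class_multiplicityE (multiplicity_self hM)).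
Qed.

End KrullSchmidt.

(** * Completeness of barcoding-equivalent invariants *)

Section Completeness.
Variables (D : essentially_small_category) (G : zmodType).
Variables (f : {additive K0sp D -> G}).

(** An element of the subgroup of [C] killed by [f] is killed by [g], which fixes it. *)
Lemma barcoding_equivalent_complete (C : D -> Prop) :
  barcoding_equivalent C f -> complete C f.
Proof.
move=> [g [hg fg]] x /fg gx0 xC.
by have := hg (GeneratedSubgroup xC); rewrite gx0 => /(congr1 val) /= <-.
Qed.

Lemma K0sub_subset (C C' : D -> Prop) : (forall X, C X -> C' X) ->
  {subset K0sub C <= K0sub C'}.
Proof.
move=> CC' x /asboolP hx; apply/asboolP; elim: hx => [y [X [CX iX ->]]||y z _ hy _ hz].
- by apply: generated_gen; exists X; split=> //; apply: CC'.
- exact: generated0.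
exact: generatedB.
Qed.

End Completeness.

(** If all local objects of [C'] were in [C], decomposing each object of [C'] into local summands
    would give [C' = C]. *)
Lemma exists_local_in_difference (D : essentially_small_category)
    (C C' : D -> Prop) : krull_schmidt D ->
  subcategory C C' -> subcategory C' (fun=> True) -> C <> C' ->
  exists M : D, [/\ local_ring (End M), C' M & ~ C M].
Proof.
move=> hD hC hC' CC'; apply: contrapT => noM; apply: CC'.
have hC1 := subcategory_trans hC hC'.
apply/funext => X; apply/propext; split=> [|C'X]; first by case: hC => + _ _ _ _; apply.
have [n [F [hX hF]]] := hD.2 X.
apply/(subcategory_finite_direct_sum hD.1 hC1 hX) => k; apply: contrapT => CF.
apply: noM; exists (F k); split=> //.
exact: (subcategory_finite_direct_sum hD.1 hC' hX).1.
Qed.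

Theorem theorem3p9 (D : essentially_small_category) (hD : krull_schmidt D)
    (C C' : D -> Prop)
    (hC : subcategory C C') (hCC' : C <> C')
    (hC' : subcategory C' (fun _ : D => True))
    (G : zmodType) (f : {additive K0sp D -> G}) :
  barcoding_equivalent C f ->
  [/\ complete C f, ~ complete C' f & ~ barcoding_equivalent C' f].
Proof.
move=> hf.
suff ncomplete : ~ complete C' f.
  split=> //; first exact: barcoding_equivalent_complete.
  by move/barcoding_equivalent_complete.
move=> f_complete; case: hf => [g [hg fg]].
have [M [hM C'M CM]] := exists_local_in_difference hD hC hC' hCC'.
set m := K0_class M.
have mC' : m \in K0sub C'.
  by apply/asboolP/generated_gen; exists M; split=> //; apply: local_indecomposable.
have gmC : val (g m) \in K0sub C := valP (g m).
(* Since [g] fixes [val (g m)], it kills the difference, and equivalence passes this to [f]. *)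
have fx0 : f (m - val (g m)) = 0 by apply/fg; rewrite raddfB hg subrr.
have xC' : m - val (g m) \in K0sub C'.
  by apply: rpredB => //; apply: (K0sub_subset _ gmC); case: hC.
have /eqP := f_complete _ fx0 xC'; rewrite subr_eq0 => /eqP mgm.
by have := K0_class_notin_K0sub hD hM (subcategory_trans hC hC') CM;
  rewrite -/m mgm gmC.
Qed.
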